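(* For any integer $t\ge 0$ and for any prime $p>2t+1$, $$S^q_{p-1}(\{2\}^t)\equiv (1-q)^{2t}\sum_{i=0}^t\left(t\binom{t-1}{i}+(t-1)\binom{t}{i}\right)(-1)^{i}K_{2t-i}(p)\pmod{[p]_q}.$$
   Context: Here $q$ is an indeterminate and $[n]_q=\frac{1-q^n}{1-q}=1+q+\cdots+q^{n-1}$. For positive integers $s_1,\dots,s_l$, $$S_n^q(s_1,\ldots,s_l)=\sum_{1\le k_1\le\cdots\le k_l\le n}\prod_{i=1}^l\frac{q^{(s_i-1)k_i}}{[k_i]_q^{s_i}},\qquad S_n^q(\emptyset)=1.$$ $\{s\}^t$ denotes $t\ge 0$ consecutive copies of $s$. The rational numbers $K_n(p)$ ($n\ge0$) are defined by the expansion about $z=1$ $$\frac{p(z-1)}{z^p-1}=\sum_{n=0}^{\infty}(-1)^{n-1}K_n(p)(z-1)^n$$ (so $K_0(p)=-1$, $K_1(p)=-\frac{p-1}{2}$, $K_2(p)=-\frac{p^2-1}{12}$). For a prime $p$ and rational functions $A,B$ in $q$, $A\equiv B\pmod{[p]_q}$ means $A-B=f/g$ with $f,g$ polynomials in $q$ with integer coefficients, $g$ coprime to $[p]_q$ in $\mathbb{Q}[q]$, and $[p]_q\mid f$ ($[p]_q$ is the $p$th cyclotomic polynomial, irreducible over $\mathbb{Q}$). *)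

(* Defs.v *)
From HB Require Import structures.
From mathcomp Require Import all_boot all_order all_algebra.

Set Implicit Arguments.
Unset Strict Implicit.
Unset Printing Implicit Defensive.

Import Order.TTheory GRing.Theory Num.Theory.
Local Open Scope ring_scope.

Notation Qq := {fraction {poly rat}}.

Definition polyF (f : {poly rat}) : Qq := FracField.tofrac f.

Definition ratF (c : rat) : Qq := polyF c%:P.

Definition qv : Qq := polyF 'X.

(* [n]_x = 1 + x + ... + x^(n-1); used both with x = 'X over int and with
   x = qv. *)
Definition qnum (R : nzRingType) (x : R) (n : nat) : R := \sum_(i < n) x ^+ i.

Definition polyQ (f : {poly int}) : {poly rat} := map_poly intr f.

(* S_n^q(s_1, ..., s_l).  The entries k_i range over {0, ..., n} and
   [path leq 1 k] says 1 <= k_1 <= ... <= k_l.  The entries of s are meant to be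
   positive, so that the subtraction in the exponent is exact. *)
Definition Sq (n : nat) (s : seq nat) : Qq :=
  \sum_(k : (size s).-tuple 'I_n.+1 | path leq 1%N [seq nat_of_ord j | j <- k])
    \prod_(i < size s)
      (qv ^+ ((nth 0 s i - 1) * tnth k i) / qnum qv (tnth k i) ^+ nth 0 s i).

(* A = B modulo [p]_q.  The divisibility of f is in Z[q]; as [p]_q is monic,
   this is the same as divisibility in Q[q]. *)
Definition eqmod_qnum (p : nat) (A B : Qq) : Prop :=
  exists f g : {poly int},
    [/\ A - B = polyF (polyQ f) / polyF (polyQ g),
        coprimep (polyQ g) (polyQ (qnum 'X p))
      & exists h : {poly int}, f = h * qnum 'X p].

(* num / den = \sum_n a_n (z - 1)^n as formal power series in z - 1, i.e.
   den * \sum_n a_n (z - 1)^n = num, after the substitution z = 'X + 1. *)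
Definition expansion_at1 (num den : {poly rat}) (a : nat -> rat) : Prop :=
  forall n : nat,
    \sum_(i < n.+1) (den \Po ('X + 1))`_(n - i) * a i = (num \Po ('X + 1))`_n.

(* p (z - 1) / (z^p - 1) = \sum_n (-1)^(n-1) K_n(p) (z - 1)^n; the exponent
   n - 1 is an integer, equal to -1 for n = 0.  For p > 0 this determines K: see
   Knum_exists and Knum_unique. *)
Definition is_Knum (p : nat) (K : nat -> rat) : Prop :=
  expansion_at1 (p%:R *: ('X - 1)) ('X^p - 1)
    (fun n => (-1) ^ (n%:Z - 1) * K n).

Lemma Knum_denE (p : nat) (n : nat) :
  (('X^p - 1 : {poly rat}) \Po ('X + 1))`_n = 'C(p, n)%:R - (n == 0)%:R.
Proof.
rewrite comp_polyB comp_Xn_poly comp_polyC coefB coefC.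
have -> : ((('X + 1) ^+ p : {poly rat})`_n = 'C(p, n)%:R); last by case: eqP.
rewrite (addrC 'X) exprDn coef_sum.
under eq_bigr => i _ do rewrite expr1n mul1r coefMn coefXn.
have [hn | hn] := ltnP n p.+1.
  rewrite (bigD1 (Ordinal hn)) //= eqxx big1 ?addr0 // => i.
  by rewrite -val_eqE /= eq_sym => /negPf ->; rewrite mul0rn.
rewrite big1 ?bin_small // => i _; case: eqP => [e | _]; rewrite ?mul0rn //.
by move: (ltn_ord i); rewrite -e ltnNge hn.
Qed.

Lemma Knum_numE (p : nat) (n : nat) :
  ((p%:R *: ('X - 1) : {poly rat}) \Po ('X + 1))`_n = p%:R * (n == 1)%:R.
Proof.
by rewrite comp_polyZ comp_polyB comp_polyX comp_polyC addrK coefZ coefX.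
Qed.

Lemma Knum_step (p : nat) (a : nat -> rat) :
  expansion_at1 (p%:R *: ('X - 1)) ('X^p - 1) a <->
  (forall n, p%:R * a n
     = p%:R * (n == 0)%:R - \sum_(i < n) 'C(p, n.+1 - i)%:R * a i).
Proof.
have E n : \sum_(i < n.+2) (('X^p - 1 : {poly rat}) \Po ('X + 1))`_(n.+1 - i)
      * a i = \sum_(i < n) 'C(p, n.+1 - i)%:R * a i + p%:R * a n.
  rewrite 2!big_ord_recr /= subnn subSnn !Knum_denE bin0 bin1 subrr mul0r.
  rewrite addr0 subr0; congr (_ + _).
  apply: eq_bigr => i _; rewrite Knum_denE subSn ?subr0 //.
  exact: ltnW.
split=> [H n | H [|n]].
- by have := H n.+1; rewrite E Knum_numE eqSS => <-; rewrite addrC addKr.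
- by rewrite big_ord1 Knum_denE Knum_numE bin0 subrr mul0r mulr0.
- by rewrite E H Knum_numE eqSS addrC subrK.
Qed.

Fixpoint Knum_tab (p n : nat) : seq rat :=
  if n is m.+1 then
    let s := Knum_tab p m in
    rcons s ((m == 0)%:R
      - (\sum_(i < m) 'C(p, m.+1 - i)%:R * nth 0 s i) / p%:R)
  else [::].

Lemma sign_pred (n : nat) :
  (-1) ^ (n%:Z - 1) * (-1) ^ (n%:Z - 1) = 1 :> rat.
Proof. by rewrite -expfzMl mulrNN mulr1 exp1rz. Qed.

Lemma Knum_exists (p : nat) (p_gt0 : (0 < p)%N) : exists K, is_Knum p K.
Proof.
have p0 : p%:R != 0 :> rat by rewrite pnatr_eq0 -lt0n.
pose a n : rat := nth 0 (Knum_tab p n.+1) n.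
have sz n : size (Knum_tab p n) = n by elim: n => //= n IH; rewrite size_rcons IH.
have tabE n i : (i < n)%N -> nth 0 (Knum_tab p n) i = a i.
  elim: n => // n IH; rewrite ltnS leq_eqVlt => /predU1P[-> // | lt_in].
  by rewrite /= nth_rcons sz lt_in IH.
exists (fun n => (-1) ^ (n%:Z - 1) * a n).
apply/Knum_step => n; rewrite mulrA sign_pred mul1r.
rewrite {1}/a /= nth_rcons sz ltnn eqxx mulrBr; congr (_ - _).
rewrite mulrC divfK //; apply: eq_bigr => i _.
by rewrite tabE // mulrA sign_pred mul1r.
Qed.

Lemma Knum_unique (p : nat) (p_gt0 : (0 < p)%N) (K L : nat -> rat) :
  is_Knum p K -> is_Knum p L -> K =1 L.
Proof.
have p0 : p%:R != 0 :> rat by rewrite pnatr_eq0 -lt0n.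
move=> /Knum_step hK /Knum_step hL n.
have e : (-1) ^ (n%:Z - 1) * K n = (-1) ^ (n%:Z - 1) * L n.
  elim/ltn_ind: n => n IH; apply: (mulfI p0); rewrite hK hL; congr (_ - _).
  by apply: eq_bigr => i _; rewrite IH.
by rewrite -[K n]mul1r -[L n]mul1r -(sign_pred n) -!mulrA e.
Qed.

(* Main.v *)
Require Import Defs.
From mathcomp Require Import all_boot all_order all_algebra all_field.
From mathcomp Require Import ring.

Set Implicit Arguments.
Unset Strict Implicit.
Unset Printing Implicit Defensive.

Import Order.TTheory GRing.Theory Num.Theory.
Local Open Scope ring_scope.

(** Modulo [p]_q one may put q = z, a primitive p-th root of unity; the sum
    becomes (1 - z)^(2t) h_t(y_1, ..., y_(p-1)), where h_t is the complete
    homogeneous symmetric polynomial and y_k = z^k / (1 - z^k)^2.  Put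
    u = w^2 / (1 + w) and Q(w) = ((1 + w)^p - 1) / w.  Since
    1 + w - y_k w^2 = (1 + w - z^k) (1 - z^k (1 + w)) / (1 - z^k)^2, one gets
      \sum_l h_l u^l = p^2 (1 + w)^(p-1) / Q(w)^2 = F(w) - w F'(w),
    where F = p / Q = \sum_n (-1)^(n-1) K_n w^n.  In (1 + w)^t \sum_l h_l u^l
    the coefficient of w^(2t) comes from l = t alone, so
      h_t = [w^(2t)] (1 + w)^t (F - w F').
    All power series are handled as polynomials modulo w^(2t+1). *)

(** * Complete homogeneous symmetric polynomials *)

(* The complete homogeneous symmetric polynomial of degree l at the entries of s. *)
Fixpoint hsym (R : comNzRingType) (s : seq R) (l : nat) : R :=
  if s is y :: s' then \sum_(i < l.+1) y ^+ i * hsym s' (l - i)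
  else (l == 0)%:R.

Lemma hsym0 (R : comNzRingType) (s : seq R) : hsym s 0 = 1.
Proof. by elim: s => //= y s IH; rewrite big_ord1 subn0 IH mul1r. Qed.

Arguments hsym : simpl never.

Lemma hsym_consS (R : comNzRingType) (y : R) (s : seq R) (l : nat) :
  hsym (y :: s) l.+1 = hsym s l.+1 + y * hsym (y :: s) l.
Proof.
rewrite [LHS]big_ord_recl expr0 mul1r subn0; congr (_ + _).
by rewrite big_distrr; apply: eq_bigr => i _; rewrite /= exprS subSS mulrA.
Qed.

(* Homogeneous form of \sum_l h_l u^l * \prod_y (1 - y u) = 1, with u = a / b. *)
Lemma hsym_gen (R : comNzRingType) (s : seq R) (t : nat) (a b : R) :
  exists r, (\sum_(l < t.+1) hsym s l * a ^+ l * b ^+ (t - l))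
              * \prod_(y <- s) (b - y * a) = b ^+ (t + size s) + a ^+ t.+1 * r.
Proof.
elim: s => [|y s [r IH]].
  exists 0; rewrite big_nil mulr0 addr0 mulr1 addn0 big_ord_recl /= big1 => [|i _].
    by rewrite expr0 subn0 !mul1r addr0.
  by rewrite !mul0r.
(* Multiplying by [b - y * a] telescopes by [hsym_consS]: it removes [y] from the list, up to a
   multiple of [a ^+ t.+1]. *)
have step : (\sum_(l < t.+1) hsym (y :: s) l * a ^+ l * b ^+ (t - l))
    * (b - y * a) = b * (\sum_(l < t.+1) hsym s l * a ^+ l * b ^+ (t - l))
                    - y * hsym (y :: s) t * a ^+ t.+1.
  have up : (\sum_(l < t.+1) hsym (y :: s) l * a ^+ l * b ^+ (t - l)) * b
      = b * (\sum_(l < t.+1) hsym s l * a ^+ l * b ^+ (t - l))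
        + y * a * \sum_(l < t) hsym (y :: s) l * a ^+ l * b ^+ (t - l).
    rewrite big_ord_recl [in X in b * X]big_ord_recl !hsym0 mulrDl mulrDr.
    rewrite [_ * b]mulrC -addrA; congr (_ + _).
    rewrite big_distrl !big_distrr -big_split; apply: eq_bigr => i _.
    rewrite lift0 hsym_consS /= -(subnSK (ltn_ord i)) !exprS; ring.
  rewrite mulrBr up.
  set B := \sum_(l < t.+1) hsym s l * _ * _.
  rewrite big_ord_recr /= subnn expr0 exprS; ring.
rewrite big_cons mulrA step mulrBl -(mulrA b) IH.
exists (b * r - y * hsym (y :: s) t * \prod_(j <- s) (b - j * a)).
rewrite /= addnS !exprS; ring.
Qed.

Lemma hsym_rmorph (R S : comNzRingType) (f : {rmorphism R -> S}) (s : seq R) (l : nat) :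
  hsym (map f s) l = f (hsym s l).
Proof.
elim: s l => [|y s IHs] l; first by rewrite /hsym rmorph_nat.
elim: l => [|l IHl]; first by rewrite !hsym0 rmorph1.
by rewrite /= !hsym_consS IHs -[_ :: _]/(map _ (y :: s)) IHl rmorphD rmorphM.
Qed.

Lemma hsym_scale (R : comNzRingType) (c : R) (s : seq R) (l : nat) :
  hsym [seq c * y | y <- s] l = c ^+ l * hsym s l.
Proof.
elim: s l => [|y s IHs] l; first by case: l => [|l]; rewrite /hsym ?mulr1 ?mulr0.
elim: l => [|l IHl]; first by rewrite !hsym0 mulr1.
by rewrite /= !hsym_consS IHs -[_ :: _]/(map _ (y :: s)) IHl exprS; ring.
Qed.

(** Both sides obey the same recursion: a weakly increasing tuple with entries at least [m] either
    starts with [m], and its tail is again at least [m], or has all entries above [m]. *)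
Lemma hsym_tuple (R : comNzRingType) (x : nat -> R) (n l m : nat) :
  (m <= n.+1)%N ->
  \sum_(k : l.-tuple 'I_n.+1 | path leq m [seq nat_of_ord j | j <- k])
    \prod_(i < l) x (tnth k i)
  = hsym [seq x j | j <- index_iota m n.+1] l.
Proof.
pose T l m := \sum_(k : l.-tuple 'I_n.+1 |
  path leq m [seq nat_of_ord j | j <- k]) \prod_(i < l) x (tnth k i).
have T0 q : T 0 q = 1.
  rewrite /T (big_pred1 [tuple]) => [|k]; first by rewrite big_ord0.
  by rewrite (tuple0 k) [RHS]eqxx.
have TS l' q : T l'.+1 q = \sum_(j < n.+1 | (q <= j)%N) x j * T l' j.
  under eq_bigr => j _ do rewrite big_distrr.
  rewrite pair_big_dep /=.
  rewrite /T (reindex (fun u : 'I_n.+1 * l'.-tuple 'I_n.+1 =>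
    [tuple of u.1 :: u.2])) /=; last first.
    exists (fun k => (thead k, [tuple of behead k])) => [[j k]|k] _.
      by congr (_, _); apply: val_inj.
    by rewrite -tuple_eta.
  apply: eq_bigr => -[j k] _; rewrite big_ord_recl /= tnth0; congr (_ * _).
  by apply: eq_bigr => i _; rewrite tnthS.
rewrite -/(T l m) => le_mn.
(* Induction on [d], the length of the range from [m] to [n]; the case [d = 0] is the empty
   range. *)
rewrite -[m](subKn le_mn); move: (n.+1 - m)%N (leq_subr m n.+1) => d {m le_mn}.
elim: d l => [|d IHd] l le_d.
  rewrite subn0 /index_iota subnn /=; case: l => [|l]; first by rewrite T0 hsym0.
  by rewrite TS big_pred0 // => j; rewrite leqNgt ltn_ord.
elim: l => [|l IHl]; first by rewrite T0 hsym0.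
have lt_d : (n.+1 - d.+1 < n.+1)%N by rewrite ltn_subrL.
have eS : (n.+1 - d.+1).+1 = (n.+1 - d)%N by rewrite subnSK.
have e : index_iota (n.+1 - d.+1) n.+1
    = (n.+1 - d.+1)%N :: index_iota (n.+1 - d) n.+1.
  by rewrite /index_iota !subKn // ?(ltnW le_d) //= eS.
rewrite e hsym_consS -/(map _ (_ :: _)) -e -IHl -(IHd _ (ltnW le_d)).
rewrite TS (bigD1 (Ordinal lt_d)) //= addrC; congr (_ + _).
rewrite TS; apply: eq_bigl => j; rewrite -eS -val_eqE /= andbC eq_sym.
by rewrite -ltn_neqAle.
Qed.

(** * Truncated power series and products over roots of unity *)

Lemma polyXn_factor (R : nzRingType) (N : nat) (P : {poly R}) :
  (forall n, (n < N)%N -> P`_n = 0) -> exists r, P = r * 'X^N.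
Proof.
move=> P0; exists (drop_poly N P).
rewrite -[LHS](poly_take_drop N) (_ : take_poly N P = 0) ?add0r //.
by apply/polyP => i; rewrite coef_take_poly coef0; case: ifP => // /P0.
Qed.

Lemma coef_X1exp (R : comNzRingType) (m n : nat) :
  (('X + 1 : {poly R}) ^+ m)`_n = 'C(m, n)%:R.
Proof.
rewrite addrC exprDn coef_sum.
under eq_bigr => i _ do rewrite expr1n mul1r coefMn coefXn.
have [hn | hn] := ltnP n m.+1.
  rewrite (bigD1 (Ordinal hn)) //= eqxx big1 ?addr0 // => i.
  by rewrite -val_eqE /= eq_sym => /negPf ->; rewrite mul0rn.
rewrite big1 ?bin_small // => i _; case: eqP => [e | _]; rewrite ?mul0rn //.
by move: (ltn_ord i); rewrite -e ltnNge hn.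
Qed.

Lemma prod_sub_prim (F : fieldType) (p : nat) (z : F) (a : {poly F}) :
  p.-primitive_root z ->
  (\prod_(1 <= k < p) (a - (z ^+ k)%:P)) * (a - 1) = a ^+ p - 1.
Proof.
move=> pz; have p_gt0 := prim_order_gt0 pz.
have /(congr1 (fun f => f \Po a)) := factor_Xn_sub_1 pz.
rewrite comp_polyB comp_Xn_poly comp_polyC => <-.
rewrite rmorph_prod [in RHS]big_ltn //= expr0 comp_polyB comp_polyX comp_polyC mulrC.
by congr (_ * _); apply: eq_bigr => k _; rewrite comp_polyB comp_polyX comp_polyC.
Qed.

Lemma prod_opp_prim (F : fieldType) (p : nat) (z : F) :
  p.-primitive_root z -> \prod_(1 <= k < p) (- z ^+ k) = 1.
Proof.
move=> pz; have /(congr1 (coefp 0)) := prod_sub_prim 0 pz.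
rewrite sub0r mulrN1 expr0n eqn0Ngt (prim_order_gt0 pz) sub0r /= !coefN coef1.
move/oppr_inj.
under eq_bigr => k _ do rewrite sub0r -polyCN.
by rewrite -rmorph_prod coefC.
Qed.

(** Reversal pairs [- z ^+ k] with [a - z ^+ (p - k)], and their product is [1 - z ^+ k * a]; the
    extra factors multiply to 1 by [prod_opp_prim]. *)
Lemma prod_rev_prim (F : fieldType) (p : nat) (z : F) (a : {poly F}) :
  p.-primitive_root z ->
  \prod_(1 <= k < p) (1 - (z ^+ k)%:P * a) = \prod_(1 <= k < p) (a - (z ^+ k)%:P).
Proof.
move=> pz; rewrite [in RHS]big_nat_rev -[RHS]mul1r.
rewrite -[X in X * _]polyC1 -[X in X%:P * _](prod_opp_prim pz) rmorph_prod -big_split /=.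
rewrite big_nat_cond [RHS]big_nat_cond; apply: eq_bigr => k /andP[/andP[_ lt_kp] _].
rewrite add1n subSS mulrBr -polyCM mulNr -exprD subnKC 1?ltnW // (prim_expr_order pz).
by rewrite !polyCN polyC1 opprK mulNr addrC.
Qed.

(** With y = z^k, each factor is (1 - y)^2 a - y (a - 1)^2 = (a - y)(1 - y a); [prod_rev_prim] turns
    the second factors into the first. *)
Lemma prod_quad_prim (F : fieldType) (p : nat) (z : F) (a : {poly F}) :
  p.-primitive_root z ->
  (\prod_(1 <= k < p) (1 - z ^+ k) ^+ 2)%:P
    * \prod_(1 <= k < p) (a - (z ^+ k / (1 - z ^+ k) ^+ 2)%:P * (a - 1) ^+ 2)
  = (\prod_(1 <= k < p) (a - (z ^+ k)%:P)) ^+ 2.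
Proof.
move=> pz; rewrite [RHS]expr2 -[X in _ = _ * X](prod_rev_prim a pz) rmorph_prod -!big_split /=.
rewrite big_nat_cond [RHS]big_nat_cond; apply: eq_bigr => k /andP[/andP[k0 lt_kp] _].
have nz : 1 - z ^+ k != 0.
  rewrite subr_eq0 eq_sym -(prim_order_dvd pz); apply/negP => /dvdn_leq.
  by rewrite k0 leqNgt lt_kp => /(_ isT).
set y := z ^+ k; set u := (1 - y) ^+ 2.
have -> : u%:P * (a - (y / u)%:P * (a - 1) ^+ 2) = u%:P * a - y%:P * (a - 1) ^+ 2.
  by rewrite mulrBr mulrA -polyCM (mulrCA u) divff ?mulr1 // expf_neq0.
rewrite /u rmorphXn /= polyCB polyC1; ring.
Qed.

(** The hypothesis on [a] says that its generating series is F = p / Q. The factor 1 - n on a_n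
    comes from F - w F', the binomial from (1 + w)^t. *)
Lemma hsym_coef (F : fieldType) (p t : nat) (z : F) (a : nat -> F) :
    p.-primitive_root z ->
    (forall n, \sum_(i < n.+1) 'C(p, n.+1 - i)%:R * a i = p%:R * (n == 0)%:R) ->
  hsym [seq z ^+ k / (1 - z ^+ k) ^+ 2 | k <- index_iota 1 p] t
  = \sum_(i < t.+1) 'C(t, i)%:R * (1 - (2 * t - i)%:R) * a (2 * t - i)%N.
Proof.
move=> pz ha; have p_gt0 := prim_order_gt0 pz.
pose b : {poly F} := 'X + 1; pose N := (2 * t).+1.
pose Q : {poly F} := \prod_(1 <= k < p) (b - (z ^+ k)%:P).
have QX : Q * 'X = b ^+ p - 1 by rewrite -(prod_sub_prim b pz) addrK.
pose f : {poly F} := \poly_(i < N) a i.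
have Q0 : Q`_0 = p%:R.
  by have /(congr1 (coefp 1)) := QX; rewrite /= coefMX coefB coef_X1exp bin1 coef1 subr0.
(* Q(0) is the product of the nonzero numbers 1 - z^k, so p is invertible in [F] and Q is coprime to
   'X. *)
have Q0nz : p%:R != 0 :> F.
  rewrite -Q0 /Q -horner_coef0 horner_prod prodf_seq_neq0.
  apply/allP => k; rewrite mem_index_iota => /andP[k0 lt_kp] /=.
  rewrite /b !hornerE subr_eq0 eq_sym -(prim_order_dvd pz).
  by apply/negP => /dvdn_leq; rewrite k0 leqNgt lt_kp => /(_ isT).
have [r fQ] : exists r, f * Q - p%:R%:P = r * 'X^N.
  apply: polyXn_factor => n lt_nN; rewrite coefB coefC.
  have -> : (f * Q)`_n = (f * (b ^+ p - 1))`_n.+1 by rewrite -QX mulrA coefMX.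
  rewrite coefM big_ord_recr subnn coefB coef_X1exp coef1 bin0 subrr mulr0 /= addr0.
  apply/eqP; rewrite subr_eq0 (_ : (if _ then _ else _) = p%:R * (n == 0)%:R).
    rewrite -ha; apply/eqP; apply: eq_bigr => i _ /=.
    rewrite coef_poly (leq_ltn_trans _ lt_nN) -1?ltnS ?ltn_ord // mulrC.
    by rewrite coefB coef_X1exp coef1 subn_eq0 leqNgt ltn_ord subr0.
  by case: eqP; rewrite ?mulr1 ?mulr0.
(* Differentiate f Q = p + r X^N and use (Q X)' = p b^(p-1). The factor 'X in front of f' keeps the
   error a multiple of X^N. *)
have fQ2 : (f - 'X * f^`()) * Q ^+ 2 = p%:R ^+ 2 *: b ^+ p.-1
   + 'X^N * (r * Q + 'X * Q^`() * r - 'X * Q * r^`() - N%:R * Q * r).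
  have e1 : f * Q = p%:R%:P + r * 'X^N by rewrite -fQ addrC subrK.
  have dQ : Q^`() * 'X + Q = p%:R *: b ^+ p.-1.
    have /(congr1 (@deriv F)) := QX; rewrite derivM derivX mulr1 => ->.
    by rewrite derivB derivC subr0 deriv_exp /b derivD derivX derivC addr0 mul1r scaler_nat.
  have dfQ : 'X * (f^`() * Q) = 'X * r^`() * 'X^N + N%:R * r * 'X^N - 'X * f * Q^`().
    have /(congr1 (fun u => 'X * u^`())) := e1.
    rewrite derivM derivD derivC add0r derivM derivXn /= mulrDr => /(canRL (addrK _)) ->.
    by rewrite exprS -mulr_natr; ring.
  have -> : p%:R ^+ 2 *: b ^+ p.-1 = p%:R%:P * (Q^`() * 'X + Q).
    by rewrite dQ mul_polyC scalerA.
  have -> : (f - 'X * f^`()) * Q ^+ 2 = Q * (f * Q) - Q * ('X * (f^`() * Q)) by ring.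
  rewrite dfQ mulrBr opprB (_ : Q * ('X * f * Q^`()) = 'X * Q^`() * (f * Q)); last by ring.
  by rewrite e1; ring.
set s := map _ _.
have sz_s : size s = p.-1 by rewrite size_map size_iota subn1.
(* b^t times the sum of h_l u^l for l up to t, where u = X^2 / b, with denominators cleared. *)
pose g : {poly F} := \sum_(l < t.+1) hsym s l *: ('X ^+ 2) ^+ l * b ^+ (t - l).
have [r2 gQ] : exists r2, g * Q ^+ 2 = p%:R ^+ 2 *: b ^+ (t + p.-1) + 'X^N * r2.
  have [r2 er] := hsym_gen (map polyC s) t ('X^2) b.
  exists ('X * r2 * (p%:R ^+ 2)%:P).
  have := prod_quad_prim b pz; rewrite -/Q /b addrK -/b => <-.
  have -> : \prod_(1 <= k < p) (1 - z ^+ k) ^+ 2 = p%:R ^+ 2.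
    rewrite prodrXl -Q0 -horner_coef0 horner_prod.
    by congr (_ ^+ 2); apply: eq_bigr => k _; rewrite /b !hornerE.
  have := er; rewrite size_map sz_s !big_map.
  have hC l : hsym (map polyC s) l = (hsym s l)%:P by exact: hsym_rmorph.
  rewrite (_ : bigop.body _ _ _ = g); last first.
    by apply: eq_bigr => l _; rewrite hC mul_polyC.
  rewrite mulrCA => ->.
  (* The error term u^(t+1) contributes X^(2t+2), beyond the precision N = 2t + 1. *)
  have -> : ('X^2) ^+ t.+1 = 'X * 'X^N :> {poly F} by rewrite -exprM -exprS mulnS.
  by rewrite -mul_polyC; ring.
(* Both polynomials have the same product with Q^2 modulo X^N, and Q^2 can be cancelled. *)
have : 'X^N %| Q ^+ 2 * (b ^+ t * (f - 'X * f^`()) - g).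
  have -> : Q ^+ 2 * (b ^+ t * (f - 'X * f^`()) - g)
    = b ^+ t * ((f - 'X * f^`()) * Q ^+ 2) - g * Q ^+ 2 by ring.
  rewrite fQ2 gQ exprD -!mul_polyC mulrDr [_ ^+ t * (_ * _)]mulrCA opprD addrACA subrr.
  by rewrite add0r mulrCA dvdp_sub // dvdp_mulr.
rewrite Gauss_dvdpr; last first.
  rewrite coprimep_sym coprimep_pexpr // coprimep_pexpl // coprimepX.
  by rewrite rootE horner_coef0 Q0.
case/dvdpP => w ew.
have := congr1 (coefp (2 * t)) ew.
rewrite /= coefMXn ltnSn coefB => /eqP; rewrite subr_eq0 => /eqP e.
(* For l < t the term X^(2l) (1 + X)^(t-l) has degree t + l < 2t, so only l = t counts. *)
have <- : g`_(2 * t) = hsym s t.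
  rewrite coef_sum (bigD1 ord_max) //= subnn mulr1 coefZ -exprM coefXn eqxx mulr1.
  rewrite big1 ?addr0 // => l; rewrite -val_eqE /= => nt.
  have lt_lt : (l < t)%N by rewrite ltn_neqAle nt -ltnS ltn_ord.
  rewrite -scalerAl coefZ -exprM ['X^_ * _]mulrC coefMXn ltnNge leq_mul2l ltnW //=.
  by rewrite coef_X1exp bin_small ?mulr0 // -mulnBr ltn_Pmull ?subn_gt0.
rewrite -e coefM.
rewrite (big_ord_widen N (fun i => 'C(t, i)%:R * (1 - (2 * t - i)%:R) * a (2 * t - i)%N)).
  rewrite [RHS]big_mkcond /=; apply: eq_bigr => i _.
  rewrite coef_X1exp; case: ltnP => [lt_it | /bin_small ->]; last by rewrite mul0r.
  rewrite -mulrA; congr (_ * _).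
  rewrite coefB coefXM; case: (2 * t - i)%N (leq_subr i (2 * t)) => [|m] le_m.
    by rewrite coef_poly /= !subr0 mul1r.
  by rewrite /= coef_deriv coef_poly ltnS le_m -mulr_natr; ring.
by rewrite ltnS -[X in (X <= _)%N]mul1n leq_mul2r orbT.
Qed.

(** * Evaluation at a root of unity and congruence modulo [p]_q *)

Lemma Cyclotomic_prime (p : nat) : prime p -> 'Phi_p = qnum 'X p.
Proof.
move=> p_pr; have p_gt0 := prime_gt0 p_pr.
have Phi1 : 'Phi_1 = 'X - 1 by rewrite -['X]expr1 -prod_Cyclotomic // big_seq1.
have perm_p : perm_eq (divisors p) [:: 1%N; p].
  apply: uniq_perm; rewrite ?divisors_uniq //=.
    by rewrite inE eq_sym (gtn_eqF (prime_gt1 p_pr)).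
  move=> d; rewrite -dvdn_divisors // !inE.
  by case/primeP: p_pr => _ /(_ d) H; apply/idP/idP => [/H //|/pred2P[]->].
have := prod_Cyclotomic p_gt0; rewrite (perm_big _ perm_p) big_cons big_seq1 Phi1.
by rewrite subrX1 => /mulfI -> //; rewrite monic_neq0 // monicXsubC.
Qed.

Lemma polyFD : {morph polyF : f g / f + g}.
Proof. exact: tofracD. Qed.

Lemma polyFM : {morph polyF : f g / f * g}.
Proof. exact: tofracM. Qed.

(* [A] is regular at [z], with value [a] there. *)
Definition has_value (z : algC) (A : Qq) (a : algC) : Prop :=
  exists f g : {poly rat},
    [/\ A = polyF f / polyF g, (map_poly ratr g).[z] != 0
      & a = (map_poly ratr f).[z] / (map_poly ratr g).[z]].

Lemma horner_neq0 (z : algC) (g : {poly rat}) :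
  (map_poly ratr g).[z] != 0 -> polyF g != 0.
Proof.
by apply: contraNneq => /eqP; rewrite /polyF tofrac_eq0 => /eqP ->; rewrite rmorph0 horner0.
Qed.

Lemma has_value_poly (z : algC) (f : {poly rat}) :
  has_value z (polyF f) (map_poly ratr f).[z].
Proof.
by exists f, 1; rewrite rmorph1 hornerC /polyF tofrac1 !divr1 oner_neq0.
Qed.

Lemma has_value_rat (z : algC) (c : rat) : has_value z (ratF c) (ratr c).
Proof. by have := has_value_poly z c%:P; rewrite map_polyC hornerC. Qed.

Lemma has_value_add (z : algC) (A B : Qq) (a b : algC) :
  has_value z A a -> has_value z B b -> has_value z (A + B) (a + b).
Proof.
move=> [f [g [-> gz ->]]] [f' [g' [-> gz' ->]]].
exists (f * g' + f' * g), (g * g').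
rewrite !rmorphD !rmorphM /= !hornerE; split.
- rewrite polyFD (polyFM f) (polyFM f') (polyFM g g').
  exact: addf_div (horner_neq0 gz) (horner_neq0 gz').
- by rewrite mulf_neq0.
- exact: addf_div.
Qed.

Lemma has_value_mul (z : algC) (A B : Qq) (a b : algC) :
  has_value z A a -> has_value z B b -> has_value z (A * B) (a * b).
Proof.
move=> [f [g [-> gz ->]]] [f' [g' [-> gz' ->]]].
exists (f * f'), (g * g').
rewrite !rmorphM !hornerM; split.
- rewrite (polyFM f) (polyFM g); exact: mulf_div.
- by rewrite mulf_neq0.
- exact: mulf_div.
Qed.

Lemma has_value_inv (z : algC) (A : Qq) (a : algC) :
  a != 0 -> has_value z A a -> has_value z A^-1 a^-1.
Proof.
move=> a0 [f [g [-> gz ea]]]; exists g, f; rewrite ea !invf_div; split=> //.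
by move: a0; rewrite ea mulf_eq0 negb_or => /andP[].
Qed.

Lemma has_value_opp (z : algC) (A : Qq) (a : algC) :
  has_value z A a -> has_value z (- A) (- a).
Proof.
move=> [f [g [-> gz ->]]]; exists (- f), g; split=> //.
- by rewrite -mulNr /polyF tofracN.
- by rewrite rmorphN hornerN mulNr.
Qed.

Lemma has_value0 (z : algC) : has_value z 0 0.
Proof. by have := has_value_rat z 0; rewrite rmorph0 /ratF polyC0 /polyF tofrac0. Qed.

Lemma has_value1 (z : algC) : has_value z 1 1.
Proof. by have := has_value_rat z 1; rewrite rmorph1 /ratF polyC1 /polyF tofrac1. Qed.

Lemma has_value_sum (z : algC) (I : finType) (P : pred I) (A : I -> Qq) (a : I -> algC) :
  (forall i, P i -> has_value z (A i) (a i)) ->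
  has_value z (\sum_(i | P i) A i) (\sum_(i | P i) a i).
Proof.
move=> h; apply: (big_rec2 (has_value z)) => [|i B b Pi hB]; first exact: has_value0.
exact: has_value_add (h i Pi) hB.
Qed.

Lemma has_value_prod (z : algC) (I : finType) (P : pred I) (A : I -> Qq) (a : I -> algC) :
  (forall i, P i -> has_value z (A i) (a i)) ->
  has_value z (\prod_(i | P i) A i) (\prod_(i | P i) a i).
Proof.
move=> h; apply: (big_rec2 (has_value z)) => [|i B b Pi hB]; first exact: has_value1.
exact: has_value_mul (h i Pi) hB.
Qed.

Lemma has_value_exp (z : algC) (A : Qq) (a : algC) (n : nat) :
  has_value z A a -> has_value z (A ^+ n) (a ^+ n).
Proof.
by move=> h; rewrite -[n]card_ord -!prodr_const; apply: has_value_prod.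
Qed.

Lemma has_value_qv (z : algC) : has_value z qv z.
Proof. by rewrite -[X in has_value _ _ X]hornerX -(map_polyX ratr); apply: has_value_poly. Qed.

Lemma has_value_qnum (z : algC) (n : nat) : has_value z (qnum qv n) (qnum z n).
Proof. by apply: has_value_sum => i _; apply/has_value_exp/has_value_qv. Qed.

(** A - B takes the value 0 at z, and [p]_q is the minimal polynomial of z over the rationals: it
    divides the numerator and is coprime to the denominator. *)
Lemma eqmod_has_value (p : nat) (z a : algC) (A B : Qq) :
  prime p -> p.-primitive_root z -> has_value z A a -> has_value z B a ->
  eqmod_qnum p A B.
Proof.
move=> p_pr pz hA hB.
have pQZ (f : {poly int}) : map_poly ratr (polyQ f) = map_poly intr f :> {poly algC}.
  by rewrite -map_poly_comp; apply: eq_map_poly => c; rewrite /= ratr_int.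
have root_dvd (f : {poly rat}) :
    ((map_poly ratr f).[z] == 0) = (polyQ (qnum 'X p) %| f).
  have [m [em _] mP] := minCpolyP z; rewrite -rootE mP; congr (_ %| _).
  apply: (map_poly_inj (@ratr algC)); rewrite -em pQZ -Cyclotomic_prime //.
  by rewrite (Cintr_Cyclotomic pz) (minCpoly_cyclotomic pz).
have [F [G [eAB Gz eF]]] := has_value_add hA (has_value_opp hB).
have Fz : (map_poly ratr F).[z] = 0.
  by apply/eqP; move/esym/eqP: eF; rewrite subrr mulf_eq0 invr_eq0 (negPf Gz) orbF.
have [f [c c0 ef]] := rat_poly_scale F; have [g [d d0 eg]] := rat_poly_scale G.
(* F = f / c and G = g / d with f, g integral; scaling both by c d gives integral polynomials and
   leaves F / G unchanged. *)
pose k : rat := (d * c)%:~R.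
have k0 : k != 0 by rewrite intr_eq0 mulf_neq0.
have ekf : polyQ (d *: f) = k *: F.
  by rewrite /polyQ map_polyZ ef scalerA /k intrM mulfK ?intr_eq0.
have ekg : polyQ (c *: g) = k *: G.
  by rewrite /polyQ map_polyZ eg scalerA /k intrM mulrC mulKf ?intr_eq0.
have Phi_neq0 : polyQ (qnum 'X p) != 0.
  by rewrite monic_neq0 // monic_map // -Cyclotomic_prime ?Cyclotomic_monic.
exists (d *: f), (c *: g); split.
- rewrite eAB ekf ekg -!mul_polyC (polyFM _ F) (polyFM _ G) -mulf_div divff ?mul1r //.
  by rewrite /polyF tofrac_eq0 polyC_eq0.
- rewrite ekg coprimepZl // /coprimep.
  (* Write [p]_q = e * gcd. One factor vanishes at z, hence is divisible by [p]_q. For the gcd this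
     would give G(z) = 0; for e it forces the gcd to be constant. *)
  have /dvdpP[e ee] := dvdp_gcdr G (polyQ (qnum 'X p)).
  have := Phi_neq0; rewrite {1}ee mulf_eq0 negb_or => /andP[e0 gcd0].
  have := dvdpp (polyQ (qnum 'X p)).
  rewrite -root_dvd {1}ee rmorphM hornerM mulf_eq0 !root_dvd => /orP[/dvdp_leq|]; last first.
    by move/dvdp_trans/(_ (dvdp_gcdl _ _)); rewrite -root_dvd (negPf Gz).
  move=> /(_ e0); rewrite {1}ee size_mul // -subn1 leq_subLR addnC leq_add2r => le1.
  by rewrite eqn_leq le1 size_poly_gt0.
(* Divisibility over the rationals descends to the integers because [p]_q is monic, hence
   primitive. *)
- have /dvdpP_int[h ->] : qnum 'X p %| d *: f.
    rewrite -dvdp_rat_int -/(polyQ (d *: f)) -/(polyQ (qnum 'X p)) -root_dvd ekf.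
    by rewrite map_polyZ hornerZ Fz mulr0.
  by exists h; rewrite zprimitive_monic -?Cyclotomic_prime ?Cyclotomic_monic // mulrC.
Qed.

(** * The value of the sum at z, and the congruence *)

Lemma expansion_at1_binomial (p : nat) (b : nat -> rat) :
  expansion_at1 (p%:R *: ('X - 1)) ('X^p - 1) b ->
  forall n, \sum_(i < n.+1) 'C(p, n.+1 - i)%:R * ratr (b i)
    = p%:R * (n == 0)%:R :> algC.
Proof.
move=> /Knum_step hb n; have /(congr1 (@ratr algC)) := hb n.
rewrite rmorphM rmorphB rmorphM !rmorph_nat rmorph_sum big_ord_recr subSnn bin1 /= => ->.
rewrite addrC; under [X in _ - X]eq_bigr => i _ do rewrite rmorphM rmorph_nat.
by rewrite subrK.
Qed.

(** Since 1 - z^k = (1 - z) [k]_z, each z^k / [k]_z^2 is (1 - z)^2 y_k, and homogeneity extracts (1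
    - z)^(2t). The denominators are nonzero because 0 < k < p. *)
Lemma has_value_Sq (z : algC) (p t : nat) :
  p.-primitive_root z ->
  has_value z (Sq (p - 1) (nseq t 2%N))
    ((1 - z) ^+ (2 * t)
       * hsym [seq z ^+ k / (1 - z ^+ k) ^+ 2 | k <- index_iota 1 p] t).
Proof.
move=> pz; have p_gt0 := prim_order_gt0 pz.
have nz k : (0 < k < p)%N -> 1 - z ^+ k != 0.
  case/andP=> k0 lt_kp; rewrite subr_eq0 eq_sym -(prim_order_dvd pz).
  by apply/negP => /dvdn_leq; rewrite k0 leqNgt lt_kp => /(_ isT).
pose x k : algC := z ^+ k / qnum z k ^+ 2.
have qnumE k : 1 - z ^+ k = (1 - z) * qnum z k.
  by rewrite -opprB subrX1 -mulNr opprB.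
have -> : (1 - z) ^+ (2 * t)
    * hsym [seq z ^+ k / (1 - z ^+ k) ^+ 2 | k <- index_iota 1 p] t
  = hsym [seq x k | k <- index_iota 1 (p - 1).+1] t.
  rewrite exprM -hsym_scale subn1 prednK // -map_comp; congr (hsym _ t).
  apply/eq_in_map => k; rewrite mem_index_iota => /nz /=.
  rewrite qnumE mulf_eq0 negb_or => /andP[z1 _].
  by rewrite exprMn invfM (mulrCA _ (z ^+ k)) mulVKf // expf_neq0.
rewrite -hsym_tuple //.
rewrite /Sq; under eq_bigr => k _ do under eq_bigr => i _ do
  rewrite nth_nseq -[X in (_ < X)%N](size_nseq t 2%N) ltn_ord mul1n.
rewrite size_nseq; apply: has_value_sum => k path_k; apply: has_value_prod => i _.
have k_pos : (0 < tnth k i)%N.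
  have /allP := order_path_min leq_trans path_k; apply.
  by apply: map_f; apply: mem_tnth.
have k_lt : (tnth k i < p)%N by apply: leq_trans (ltn_ord _) _; rewrite subn1 prednK.
have := nz (tnth k i); rewrite k_pos k_lt qnumE mulf_eq0 negb_or => /(_ isT)/andP[_ q0].
apply: has_value_mul; first exact/has_value_exp/has_value_qv.
by apply/has_value_inv/has_value_exp/has_value_qnum; rewrite expf_neq0.
Qed.

(* For t = 0 the truncated t.-1 is harmless: 'C(t.-1, i) is multiplied by t. *)
Theorem theorem4p3 (t p : nat) (K : nat -> rat) (p_prime : prime p)
    (p_gt : (2 * t + 1 < p)%N) (K_def : is_Knum p K) :
  eqmod_qnum p (Sq (p - 1) (nseq t 2%N))
    ((1 - qv) ^+ (2 * t) *
     ratF (\sum_(0 <= i < t.+1)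
             (t%:R * 'C(t.-1, i)%:R + (t%:R - 1) * 'C(t, i)%:R)
             * (-1) ^+ i * K (2 * t - i)%N)).
Proof.
have [z pz] := C_prim_root_exists (prime_gt0 p_prime).
apply: (eqmod_has_value p_prime pz (has_value_Sq t pz)).
have ha := expansion_at1_binomial K_def.
set c := \sum_(0 <= i < t.+1) _.
have -> : hsym [seq z ^+ k / (1 - z ^+ k) ^+ 2 | k <- index_iota 1 p] t = ratr c.
  rewrite [LHS](hsym_coef (a := fun n => ratr ((-1) ^ (n%:Z - 1) * K n)) t pz ha).
  rewrite /c big_mkord rmorph_sum; apply: eq_bigr => i _ /=.
  have le_it : (i <= t)%N by rewrite -ltnS ltn_ord.
  have le_i2t : (i <= 2 * t)%N by rewrite (leq_trans le_it) // leq_pmull.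
  (* This merges the two binomials of the statement into (2t - i - 1) 'C(t, i); the sign of 1 - (2t
     - i) is absorbed by (-1)^(2t-i-1) = - (-1)^i. *)
  have bin_t : t%:R * 'C(t.-1, i)%:R = (t%:R - i%:R) * 'C(t, i)%:R :> rat.
    by rewrite -natrB // -!natrM mul_bin_down.
  have sgn : (-1) ^ ((2 * t - i)%:Z - 1) = - (-1) ^+ i :> rat.
    by rewrite expfzDr // -exprnP -(signr_odd _ (2 * t - i)) oddB // oddM signr_odd mulrN1.
  rewrite bin_t sgn.
  have -> : 'C(t, i)%:R * (1 - (2 * t - i)%:R) = ratr ('C(t, i)%:R * (1 - (2 * t - i)%:R)) :> algC.
    by rewrite rmorphM rmorphB rmorph1 !rmorph_nat.
  by rewrite -rmorphM natrB // natrM; congr ratr; ring.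
apply: has_value_mul; last exact: has_value_rat.
apply: has_value_exp; apply: has_value_add (has_value1 z) _.
exact: has_value_opp (has_value_qv z).
Qed.
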